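(* Assume that $Q_t,R_t$ ($t\in\mathbb{N}$) are positive definite, that the pair $(C,A)$ is observable, and that $A$ is invertible. Then the optimal solution of $$\min_{\mathbf{K}=(K_0,\dots,K_{M-1})\in\mathbb{R}^{N\times Mm}}\ \mathbb{E}\Big[\mathrm{tr}\Big(\sum_{t=0}^{M-1}(x_{t+1}-\hat x_{t+1})(x_{t+1}-\hat x_{t+1})^T\sum_{n=1}^{N}(CA^n)^TCA^n\Big)\Big]$$ (with $\hat x_t$ generated by $\mathbf{K}$ as in the context) is equal to the Kalman gain $(K_0^*,\dots,K_{M-1}^* )$, defined by $P_0^*=P_0$ and, for $t=0,\dots,M-1$, $$K_t^*=Z_t^*(H_t^* )^{-1},\qquad P_{t+1}^*=AP_t^*A^T+Q_t-Z_t^*(H_t^* )^{-1}Z_t^{*T},$$ $$H_t^*=CAP_t^*(CA)^T+R_{t+1}+CQ_tC^T,\qquad Z_t^*=AP_t^*(CA)^T+Q_tC^T.$$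
   Context: Let $M,N,m$ be positive integers, $A\in\mathbb{R}^{N\times N}$, $C\in\mathbb{R}^{m\times N}$. The system is $x_{t+1}=Ax_t+\omega_t$, $y_t=Cx_t+v_t$, $t\in\mathbb{N}$ ($0\in\mathbb N$), where $x_0\sim\mathcal N(\bar x_0,\Sigma_{x_0})$, $\{\omega_t\}$ and $\{v_t\}$ are Gaussian random vectors with zero mean, $\mathbb{E}[\omega_t\omega_t^T]=Q_t$, $\mathbb{E}[v_tv_t^T]=R_t$, and $x_0,\omega_t,v_t$ ($t\in\mathbb{N}$) are mutually independent. For a gain $\mathbf{K}=(K_0,\dots,K_{M-1})$ with $K_t\in\mathbb{R}^{N\times m}$, the estimates are generated by $\hat x_0=\bar x_0$ and $\hat x_{t+1}=A\hat x_t+K_tCA(x_t-\hat x_t)+K_tC\omega_t+K_tv_{t+1}$ (equivalently $\hat x_{t+1}=A\hat x_t+K_t(y_{t+1}-CA\hat x_t)$). $P_0=\mathbb{E}[(x_0-\hat x_0)(x_0-\hat x_0)^T]$. *)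

(* Defs.v *)
From HB Require Import structures.
From mathcomp Require Import all_boot all_order all_algebra.
From mathcomp Require Import all_classical all_reals all_analysis.

Set Implicit Arguments.
Unset Strict Implicit.
Unset Printing Implicit Defensive.

Import Order.TTheory GRing.Theory Num.Theory.
Import numFieldNormedType.Exports.

Local Open Scope classical_set_scope.
Local Open Scope ring_scope.

Definition posdef (R : realType) (n : nat) (S : 'M[R]_n) : Prop :=
  S^T = S /\ forall u : 'cV[R]_n, u != 0 -> 0 < (u^T *m S *m u) 0 0.

(* The observability matrix, with blocks C, CA, ..., CA^(N-1), has full column
   rank. *)
Definition observable (R : realType) (N m : nat)
    (C : 'M[R]_(m, N)) (A : 'M[R]_N) : Prop :=
  \rank (\mxcol_(i < N) (C *m A ^+ i)) = N.

(* The law N(mu, s^2). The library's [normal_prob mu 0] is the uniform law on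
   [0, 1], hence the explicit degenerate case. *)
Definition gaussian_law (R : realType) (mu s : R) (B : set R) : \bar R :=
  if s == 0 then \d_mu B else normal_prob mu s B.

(* Every linear functional of X has a (possibly degenerate) Gaussian law. *)
Definition gaussian_vector (d : measure_display) (T : measurableType d)
    (R : realType) (P : probability T R) (n : nat) (X : T -> 'cV[R]_n) : Prop :=
  (forall i, measurable_fun setT (fun w => X w i 0)) /\
  forall a : 'cV[R]_n, exists mu s : R, forall B : set R, measurable B ->
    P ((fun w => (a^T *m X w) 0 0) @^-1` B) = gaussian_law mu s B.

(* E[X] = S entrywise. The entries of S are real, which forces (for measurable
   X) the entries of X to be integrable. *)
Definition has_expectation (d : measure_display) (T : measurableType d)
    (R : realType) (P : probability T R) (p q : nat)
    (X : T -> 'M[R]_(p, q)) (S : 'M[R]_(p, q)) : Prop :=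
  forall i j, 'E_P[fun w => X w i j]%E = (S i j)%:E.

(* X ~ N(mu, S) *)
Definition has_normal_law (d : measure_display) (T : measurableType d)
    (R : realType) (P : probability T R) (n : nat) (X : T -> 'cV[R]_n)
    (mu : 'cV[R]_n) (S : 'M[R]_n) : Prop :=
  [/\ gaussian_vector P X,
      has_expectation P X mu &
      has_expectation P (fun w => (X w - mu) *m (X w - mu)^T) S].

(* The sigma-algebra on T generated by the random vector X. *)
Definition sigma_vector (T : Type) (R : realType) (n : nat)
    (X : T -> 'cV[R]_n) : set (set T) :=
  <<s [set E | exists (i : 'I_n) (B : set R),
         measurable B /\ E = (fun w => X w i 0) @^-1` B] >>.

Definition mutually_independent (d : measure_display) (T : measurableType d)
    (R : realType) (P : probability T R) (I : eqType)
    (F : I -> set (set T)) : Prop :=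
  forall (J : seq I) (E : I -> set T), uniq J ->
    (forall i, i \in J -> F i (E i)) ->
    P (\big[setI/setT]_(i <- J) E i) = (\prod_(i <- J) P (E i))%E.

(* The sigma-algebras of x_0 (index None), omega_t (index Some (inl t)) and
   v_t (index Some (inr t)). *)
Definition source_sigma (T : Type) (R : realType) (N m : nat)
    (x0 : T -> 'cV[R]_N) (omega : nat -> T -> 'cV[R]_N)
    (v : nat -> T -> 'cV[R]_m) (i : option (nat + nat)) : set (set T) :=
  match i with
  | None => sigma_vector x0
  | Some (inl t) => sigma_vector (omega t)
  | Some (inr t) => sigma_vector (v t)
  end.

Fixpoint state (T : Type) (R : realType) (N : nat) (A : 'M[R]_N)
    (x0 : T -> 'cV[R]_N) (omega : nat -> T -> 'cV[R]_N) (t : nat) (w : T) :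
    'cV[R]_N :=
  if t is s.+1 then A *m state A x0 omega s w + omega s w else x0 w.

Definition output (T : Type) (R : realType) (N m : nat) (A : 'M[R]_N)
    (C : 'M[R]_(m, N)) (x0 : T -> 'cV[R]_N) (omega : nat -> T -> 'cV[R]_N)
    (v : nat -> T -> 'cV[R]_m) (t : nat) (w : T) : 'cV[R]_m :=
  C *m state A x0 omega t w + v t w.

(* The estimates generated by K = (K_0, ..., K_(M-1)); only the times t <= M are
   meaningful, beyond which K`_t is the default value 0. *)
Fixpoint estimate (T : Type) (R : realType) (N m M : nat) (A : 'M[R]_N)
    (C : 'M[R]_(m, N)) (xbar0 : 'cV[R]_N) (x0 : T -> 'cV[R]_N)
    (omega : nat -> T -> 'cV[R]_N) (v : nat -> T -> 'cV[R]_m)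
    (K : M.-tuple 'M[R]_(N, m)) (t : nat) (w : T) : 'cV[R]_N :=
  if t is s.+1 then
    let xhat := estimate A C xbar0 x0 omega v K s w in
    A *m xhat + K`_s *m C *m A *m (state A x0 omega s w - xhat)
      + K`_s *m C *m omega s w + K`_s *m v s.+1 w
  else xbar0.

Lemma estimate_innovation (T : Type) (R : realType) (N m M : nat)
    (A : 'M[R]_N) (C : 'M[R]_(m, N)) (xbar0 : 'cV[R]_N) (x0 : T -> 'cV[R]_N)
    (omega : nat -> T -> 'cV[R]_N) (v : nat -> T -> 'cV[R]_m)
    (K : M.-tuple 'M[R]_(N, m)) (t : nat) (w : T) :
  let xhat := estimate A C xbar0 x0 omega v K in
  xhat t.+1 w = A *m xhat t w
    + K`_t *m (output A C x0 omega v t.+1 w - C *m A *m xhat t w).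
Proof.
move=> xhat; rewrite /xhat /output /=.
rewrite !mulmxBr !mulmxDr !mulmxA -!addrA; congr (_ + (_ + _)).
by rewrite addrC -!addrA.
Qed.

Definition estimation_cost (d : measure_display) (T : measurableType d)
    (R : realType) (P : probability T R) (N m M : nat) (A : 'M[R]_N)
    (C : 'M[R]_(m, N)) (xbar0 : 'cV[R]_N) (x0 : T -> 'cV[R]_N)
    (omega : nat -> T -> 'cV[R]_N) (v : nat -> T -> 'cV[R]_m)
    (K : M.-tuple 'M[R]_(N, m)) : \bar R :=
  let e t w := state A x0 omega t w - estimate A C xbar0 x0 omega v K t w in
  'E_P[fun w => \tr (\sum_(t < M) (e t.+1 w *m (e t.+1 w)^T) *m
                     \sum_(1 <= n < N.+1) (C *m A ^+ n)^T *m (C *m A ^+ n))]%E.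

Definition kalman_H (R : realType) (N m : nat) (A : 'M[R]_N) (C : 'M[R]_(m, N))
    (Q : nat -> 'M[R]_N) (Rv : nat -> 'M[R]_m) (t : nat) (P : 'M[R]_N) :
    'M[R]_m :=
  C *m A *m P *m (C *m A)^T + Rv t.+1 + C *m Q t *m C^T.

Definition kalman_Z (R : realType) (N m : nat) (A : 'M[R]_N) (C : 'M[R]_(m, N))
    (Q : nat -> 'M[R]_N) (t : nat) (P : 'M[R]_N) : 'M[R]_(N, m) :=
  A *m P *m (C *m A)^T + Q t *m C^T.

Fixpoint kalman_P (R : realType) (N m : nat) (A : 'M[R]_N) (C : 'M[R]_(m, N))
    (Q : nat -> 'M[R]_N) (Rv : nat -> 'M[R]_m) (P0 : 'M[R]_N) (t : nat) :
    'M[R]_N :=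
  if t is s.+1 then
    let P := kalman_P A C Q Rv P0 s in
    let H := kalman_H A C Q Rv s P in
    let Z := kalman_Z A C Q s P in
    A *m P *m A^T + Q s - Z *m invmx H *m Z^T
  else P0.

Definition kalman_gain (R : realType) (N m : nat) (A : 'M[R]_N)
    (C : 'M[R]_(m, N)) (Q : nat -> 'M[R]_N) (Rv : nat -> 'M[R]_m)
    (P0 : 'M[R]_N) (t : nat) : 'M[R]_(N, m) :=
  let P := kalman_P A C Q Rv P0 t in
  kalman_Z A C Q t P *m invmx (kalman_H A C Q Rv t P).

(* Main.v *)
(* The error e_t = x_t - xhat_t satisfies
     e_(t+1) = (A - K_t C A) e_t + (1 - K_t C) omega_t - K_t v_(t+1),
   with three uncorrelated terms, so its covariance S_t follows the recursion
   S_(t+1) = J(K_t, S_t), J being the Joseph form, and the cost is the sum of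
   the tr (S_(t+1) W), where W = sum_n (C A^n)^T C A^n.
   Completing the square gives J(K_t, P*_t) = P*_(t+1) + D_t H*_t D_t^T with
   D_t = K_t - K*_t. Since J is monotone in the covariance, S_(t+1) dominates
   P*_(t+1) + D_t H*_t D_t^T for every gain, with equality for K*. An optimal K
   thus has tr (D_t H*_t D_t^T W) = 0 for all t, and as W is positive definite
   (observability and invertibility of A) this forces D_t = 0. *)
Require Import Defs.
From HB Require Import structures.
From mathcomp Require Import all_boot all_order all_algebra.
From mathcomp Require Import all_classical all_reals all_analysis.
From mathcomp Require Import measurable_realfun.

Set Implicit Arguments.
Unset Strict Implicit.
Unset Printing Implicit Defensive.

Import Order.TTheory GRing.Theory Num.Theory.
Import numFieldNormedType.Exports.

Local Open Scope classical_set_scope.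
Local Open Scope ring_scope.

(** * Means of random matrices, independence and second moments *)

Section MatrixMean.
Context (d : measure_display) (T : measurableType d) (R : realType)
  (P : probability T R).

(** The integral is the difference of the integrals of the positive and negative parts, and a
    difference with an infinite term is never finite, oo - oo included. This recovers integrability
    from [has_expectation], which only asserts a real value. *)
Lemma fin_num_integral_integrable (f : T -> \bar R) :
  measurable_fun [set: T] f -> (\int[P]_w f w)%E \is a fin_num ->
  P.-integrable setT f.
Proof.
move=> mf; rewrite integralE => fin.
have f1 : (\int[P]_w (f^\+ w) < +oo)%E.
  rewrite ltey; apply: contraTneq fin => ->.
  by case: (\int[P]_w (f^\- w))%E.
have f2 : (\int[P]_w (f^\- w) < +oo)%E.
  rewrite ltey; apply: contraTneq fin => ->.
  by case: (\int[P]_w (f^\+ w))%E.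
apply/integrableP; split => //.
rewrite -[X in integral _ _ X]/(abse \o f) fune_abse ge0_integralD//.
- exact: lte_add_pinfty.
- exact: measurable_funepos.
- exact: measurable_funeneg.
Qed.

(** Independence says that the joint law agrees with the product of the marginal laws on rectangles,
    hence everywhere. Fubini on the product measure then splits the integral of x y. *)
Lemma indep_integrableM_integral (X Y : T -> R) :
  measurable_fun [set: T] X -> measurable_fun setT Y ->
  (forall A B : set R, measurable A -> measurable B ->
    P (X @^-1` A `&` Y @^-1` B) = (P (X @^-1` A) * P (Y @^-1` B))%E) ->
  P.-integrable setT (EFin \o X) -> P.-integrable setT (EFin \o Y) ->
  P.-integrable setT (fun w => (X w * Y w)%:E) /\
  (\int[P]_w (X w * Y w)%:E = \int[P]_w (X w)%:E * \int[P]_w (Y w)%:E)%E.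
Proof.
move=> mX mY XY iX iY.
pose X' : {mfun T >-> R} := HB.pack X (isMeasurableFun.Build _ _ _ _ X mX).
pose Y' : {mfun T >-> R} := HB.pack Y (isMeasurableFun.Build _ _ _ _ Y mY).
have mZ : measurable_fun [set: T] (fun w => (X w, Y w)).
  exact: measurable_fun_pair.
pose Z : {mfun T >-> (R * R)%type} :=
  HB.pack (fun w => (X w, Y w)) (isMeasurableFun.Build _ _ _ _ _ mZ).
pose mu : probability R R := distribution P X'.
pose nu : probability R R := distribution P Y'.
have muxnu A : measurable A -> (mu \x nu)%E A = distribution P Z A.
  by apply: product_measure_unique => B B' mB mB'; exact: XY.
pose f (z : R * R) := (z.1 * z.2)%:E.
have mf : measurable_fun [set: R * R] f.
  by apply/measurable_EFinP; exact: measurable_funM.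
have mE : measurable_fun [set: R] (@EFin R) by exact: EFin_measurable.
have mnE : measurable_fun [set: R] (fun x : R => `|x%:E|)%E.
  exact: measurableT_comp.
have ifX : mu.-integrable setT EFin by exact: integrable_pushforward.
have ifY : nu.-integrable setT EFin by exact: integrable_pushforward.
have if12 : (mu \x nu)%E.-integrable setT f.
  (* Tonelli: the iterated integral of |x y| factors as E|X| E|Y|, which is finite. *)
  apply/(integrable12ltyP mu nu mf).
  have -> : (fun x => \int[nu]_y `|f (x, y)|)%E =
            (fun x => (\int[nu]_y `|y%:E|) * `|x%:E|)%E.
    apply/funext => x; rewrite muleC -ge0_integralZl//.
    by apply: eq_integral => y _; rewrite /f /= normrM EFinM.
  rewrite ge0_integralZl//; last exact: integral_ge0.
  move/integrableP: ifX => [_ ifX]; move/integrableP: ifY => [_ ifY].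
  apply: lte_mul_pinfty => //; first exact: integral_ge0.
  by rewrite ge0_fin_numE// integral_ge0.
have iZ : (distribution P Z).-integrable setT f.
  move/integrableP: if12 => [_ if12]; apply/integrableP; split => //.
  rewrite (eq_measure_integral (mu \x nu)%E)// => A mA _.
  exact/esym/muxnu.
have iP : P.-integrable setT (f \o Z).
  move/integrableP: iZ => [_ iZ]; apply/integrableP; split.
    exact: measurableT_comp.
  rewrite ge0_integral_distribution// in iZ.
  exact: measurableT_comp.
split=> //.
rewrite -[LHS]/(\int[P]_w (f \o Z) w)%E -integral_distribution//.
rewrite (eq_measure_integral (mu \x nu)%E); last first.
  by move=> A mA _; exact/esym/muxnu.
rewrite -integral12_prod_meas1//.
have -> : (\int[P]_w (X w)%:E = \int[mu]_x x%:E)%E.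
  by rewrite integral_distribution.
have -> : (\int[P]_w (Y w)%:E = \int[nu]_x x%:E)%E.
  by rewrite integral_distribution.
have nufin : (\int[nu]_y y%:E)%E \is a fin_num by exact: integrable_fin_num.
rewrite -(fineK nufin) -integralZr//; apply: eq_integral => x _.
by rewrite fineK// -integralZl.
Qed.

(** Integrability is recorded next to the value, so that linearity of the integral can be applied
    repeatedly without further side conditions. *)
Definition has_mean p q (X : T -> 'M[R]_(p, q)) (S : 'M[R]_(p, q)) :=
  forall i j, P.-integrable setT (fun w => (X w i j)%:E) /\
              (\int[P]_w (X w i j)%:E = (S i j)%:E)%E.

Lemma has_expectation_mean p q (X : T -> 'M[R]_(p, q)) (S : 'M[R]_(p, q)) :
  (forall i j, measurable_fun [set: T] (fun w => X w i j)) ->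
  has_expectation P X S -> has_mean X S.
Proof.
move=> mX XS i j; have := XS i j; rewrite unlock => XSij; split => //.
apply: fin_num_integral_integrable; last by rewrite XSij.
exact/measurable_EFinP.
Qed.

Lemma eq_has_mean p q (X Y : T -> 'M[R]_(p, q)) (S S' : 'M[R]_(p, q)) :
  X =1 Y -> S = S' -> has_mean X S -> has_mean Y S'.
Proof. by move=> /funext -> ->. Qed.

Lemma has_meanD p q (X Y : T -> 'M[R]_(p, q)) (S S' : 'M[R]_(p, q)) :
  has_mean X S -> has_mean Y S' -> has_mean (fun w => X w + Y w) (S + S').
Proof.
move=> XS YS i j; have [iX EX] := XS i j; have [iY EY] := YS i j.
under eq_fun do rewrite mxE EFinD.
split; first exact: integrableD.
by rewrite integralD// EX EY mxE.
Qed.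

Lemma has_mean_sum p q n (X : 'I_n -> T -> 'M[R]_(p, q))
    (S : 'I_n -> 'M[R]_(p, q)) :
  (forall k, has_mean (X k) (S k)) ->
  has_mean (fun w => \sum_k X k w) (\sum_k S k).
Proof.
move=> XS i j; under eq_fun do rewrite summxE -sumEFin.
split; first by apply: integrable_sum => // k _; have [] := XS k i j.
rewrite integral_sum//; last by move=> k; have [] := XS k i j.
by rewrite summxE -sumEFin; apply: eq_bigr => k _; have [] := XS k i j.
Qed.

Lemma has_mean_tr p q (X : T -> 'M[R]_(p, q)) (S : 'M[R]_(p, q)) :
  has_mean X S -> has_mean (fun w => (X w)^T) S^T.
Proof. by move=> XS i j; under eq_fun do rewrite mxE; rewrite mxE. Qed.

Lemma has_meanMl p q r (A : 'M[R]_(r, p)) (X : T -> 'M[R]_(p, q))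
    (S : 'M[R]_(p, q)) :
  has_mean X S -> has_mean (fun w => A *m X w) (A *m S).
Proof.
move=> XS i j.
have E w : ((A *m X w) i j)%:E = (\sum_k (A i k)%:E * (X w k j)%:E)%E.
  by rewrite mxE -sumEFin; apply: eq_bigr => k _; rewrite EFinM.
under eq_fun do rewrite E.
have iX k : P.-integrable setT (fun w => (A i k)%:E * (X w k j)%:E)%E.
  by apply: integrableZl => //; have [] := XS k j.
split; first exact: integrable_sum.
rewrite integral_sum// mxE -sumEFin; apply: eq_bigr => k _.
by have [iXk EXk] := XS k j; rewrite integralZl// EXk EFinM.
Qed.

Lemma has_meanMr p q r (X : T -> 'M[R]_(p, q)) (S : 'M[R]_(p, q))
    (B : 'M[R]_(q, r)) :
  has_mean X S -> has_mean (fun w => X w *m B) (S *m B).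
Proof.
move=> /has_mean_tr/(has_meanMl B^T)/has_mean_tr; apply: eq_has_mean.
  by move=> w; rewrite trmx_mul !trmxK.
by rewrite trmx_mul !trmxK.
Qed.

Lemma has_mean_mxtrace n (X : T -> 'M[R]_n) (S : 'M[R]_n) :
  has_mean X S -> ('E_P[fun w => \tr (X w)] = (\tr S)%:E)%E.
Proof.
move=> XS; rewrite unlock; under eq_integral do rewrite -sumEFin.
rewrite integral_sum//; last by move=> k; have [] := XS k k.
by rewrite -sumEFin; apply: eq_bigr => k _; have [] := XS k k.
Qed.

(** Each entry of the outer product is a product of two coordinates, and preimages under coordinates
    are among the generators of [sigma_vector]. *)
Lemma has_mean_indepM p q (X : T -> 'cV[R]_p) (Y : T -> 'cV[R]_q)
    (mu : 'cV[R]_p) (nu : 'cV[R]_q) :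
  (forall i, measurable_fun [set: T] (fun w => X w i 0)) ->
  (forall i, measurable_fun [set: T] (fun w => Y w i 0)) ->
  (forall E F, sigma_vector X E -> sigma_vector Y F ->
    P (E `&` F) = (P E * P F)%E) ->
  has_mean X mu -> has_mean Y nu ->
  has_mean (fun w => X w *m (Y w)^T) (mu *m nu^T).
Proof.
move=> mX mY XY Xmu Ynu i j.
have [iX EX] := Xmu i 0; have [iY EY] := Ynu j 0.
have XYij (A B : set R) : measurable A -> measurable B ->
    P ((fun w => X w i 0%R) @^-1` A `&` (fun w => Y w j 0%R) @^-1` B) =
    (P ((fun w => X w i 0%R) @^-1` A) * P ((fun w => Y w j 0%R) @^-1` B))%E.
  move=> mA mB; apply: XY; apply: sub_sigma_algebra.
  - by exists i, A.
  - by exists j, B.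
have [] := indep_integrableM_integral (mX i) (mY j) XYij iX iY.
have E w : X w i 0 * Y w j 0 = (X w *m (Y w)^T) i j.
  by rewrite mxE big_ord1 mxE.
under eq_fun do rewrite E; rewrite EX EY => iXY ->; split => //.
by rewrite mxE big_ord1 mxE EFinM.
Qed.

Lemma has_mean_indep_cross0 p q (X : T -> 'cV[R]_p) (Y : T -> 'cV[R]_q)
    (mu : 'cV[R]_p) :
  (forall i, measurable_fun [set: T] (fun w => X w i 0)) ->
  (forall i, measurable_fun [set: T] (fun w => Y w i 0)) ->
  (forall E F, sigma_vector X E -> sigma_vector Y F ->
    P (E `&` F) = (P E * P F)%E) ->
  has_mean X mu -> has_mean Y 0 -> has_mean (fun w => X w *m (Y w)^T) 0.
Proof.
move=> mX mY XY Xmu Y0; rewrite -(mulmx0 _ mu) -trmx0.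
exact: has_mean_indepM.
Qed.

(** The two cross terms of the expanded square are transposes of each other, so one vanishing cross
    moment suffices. *)
Lemma has_mean_outerD n (X Y : T -> 'cV[R]_n) (S S' : 'M[R]_n) :
  has_mean (fun w => X w *m (X w)^T) S ->
  has_mean (fun w => Y w *m (Y w)^T) S' ->
  has_mean (fun w => X w *m (Y w)^T) 0 ->
  has_mean (fun w => (X w + Y w) *m (X w + Y w)^T) (S + S').
Proof.
move=> XS YS XY0.
have := has_meanD (has_meanD XS YS) (has_meanD XY0 (has_mean_tr XY0)).
apply: eq_has_mean => [w|]; last by rewrite trmx0 !addr0.
rewrite trmx_mul trmxK linearD /= mulmxDl !mulmxDr -!addrA; congr (_ + _).
by rewrite addrCA; congr (_ + _); rewrite addrC.
Qed.

Lemma has_mean_expectation_outer n (X : T -> 'cV[R]_n) (S : 'M[R]_n) :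
  (forall i, measurable_fun [set: T] (fun w => X w i 0)) ->
  has_expectation P (fun w => X w *m (X w)^T) S ->
  has_mean (fun w => X w *m (X w)^T) S.
Proof.
move=> mX; apply: has_expectation_mean => i j.
under eq_fun do rewrite mxE big_ord1 mxE.
exact: measurable_funM.
Qed.

Lemma has_mean_outerM p q r s (X : T -> 'cV[R]_p) (Y : T -> 'cV[R]_q)
    (S : 'M[R]_(p, q)) (F : 'M[R]_(r, p)) (G : 'M[R]_(s, q)) :
  has_mean (fun w => X w *m (Y w)^T) S ->
  has_mean (fun w => (F *m X w) *m (G *m Y w)^T) (F *m S *m G^T).
Proof.
move=> /(has_meanMl F)/(has_meanMr G^T); apply: eq_has_mean => // w.
by rewrite trmx_mul !mulmxA.
Qed.
End MatrixMean.

(** * Semidefinite matrices, trace inequalities and observability *)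

Section KalmanRiccati.
Context (R : realType).

Definition psd (n : nat) (S : 'M[R]_n) : Prop :=
  S^T = S /\ forall u : 'cV[R]_n, 0 <= (u^T *m S *m u) 0 0.

Lemma posdef_psd n (S : 'M[R]_n) : posdef S -> psd S.
Proof.
move=> [ST S_gt0]; split=> // u; have [->|/S_gt0/ltW//] := eqVneq u 0.
by rewrite mulmx0 mxE.
Qed.

Lemma psd0 n : psd (0 : 'M[R]_n).
Proof. by split=> [|u]; rewrite ?trmx0// mulmx0 mul0mx mxE. Qed.

Lemma psdD n (S S' : 'M[R]_n) : psd S -> psd S' -> psd (S + S').
Proof.
move=> [ST S0] [ST' S0']; split=> [|u]; first by rewrite linearD /= ST ST'.
by rewrite mulmxDr mulmxDl mxE addr_ge0.
Qed.

Lemma psd_congr n p (S : 'M[R]_n) (F : 'M[R]_(p, n)) :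
  psd S -> psd (F *m S *m F^T).
Proof.
move=> [ST S0]; split=> [|u]; first by rewrite !trmx_mul trmxK ST mulmxA.
by have := S0 (F^T *m u); rewrite trmx_mul trmxK !mulmxA.
Qed.

Lemma posdefDl n (S S' : 'M[R]_n) : posdef S -> psd S' -> posdef (S + S').
Proof.
move=> [ST S0] [ST' S0']; split=> [|u u0]; first by rewrite linearD /= ST ST'.
by rewrite mulmxDr mulmxDl mxE ltr_pwDl ?S0.
Qed.

(** A nonzero row of the left kernel, taken as test vector, would make the quadratic form vanish. *)
Lemma posdef_unitmx n (S : 'M[R]_n) : posdef S -> S \in unitmx.
Proof.
move=> [_ S_gt0]; rewrite -row_free_unit -kermx_eq0; apply/eqP/row_matrixP => i.
rewrite row0; apply/eqP; apply: contraTT isT => ki.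
have /S_gt0 : (row i (kermx S))^T != 0.
  by apply: contra ki => /eqP/(congr1 trmx); rewrite trmxK trmx0 => ->.
by rewrite trmxK -row_mul mulmx_ker row0 mul0mx mxE ltxx.
Qed.

Lemma mxtrace_psd_ge0 n (S : 'M[R]_n) : psd S -> 0 <= \tr S.
Proof.
move=> [_ S0]; apply: sumr_ge0 => i _.
have := S0 (delta_mx i 0).
by rewrite trmx_delta -rowE -colE !mxE.
Qed.

(** Cyclicity of the trace turns a Gram weight into a sum of congruences of [S], on which positivity
    is visible. *)
Lemma mxtrace_gram n p I (r : seq I) (S : 'M[R]_n) (B : I -> 'M[R]_(p, n)) :
  \tr (S *m \sum_(k <- r) (B k)^T *m B k) =
  \sum_(k <- r) \tr (B k *m S *m (B k)^T).
Proof.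
rewrite mulmx_sumr raddf_sum; apply: eq_bigr => k _ /=.
by rewrite mulmxA mxtrace_mulC mulmxA.
Qed.

Lemma mxtrace_psd_gram_ge0 n p I (r : seq I) (S : 'M[R]_n)
    (B : I -> 'M[R]_(p, n)) :
  psd S -> 0 <= \tr (S *m \sum_(k <- r) (B k)^T *m B k).
Proof.
move=> S0; rewrite mxtrace_gram; apply: sumr_ge0 => k _.
exact/mxtrace_psd_ge0/psd_congr.
Qed.

(** The trace is the sum of the values of the form [H] at the rows of [D]. These are nonnegative, so
    all vanish, and definiteness kills every row. *)
Lemma mxtrace_posdef_congr_eq0 n p (H : 'M[R]_n) (D : 'M[R]_(p, n)) :
  posdef H -> \tr (D *m H *m D^T) = 0 -> D = 0.
Proof.
move=> [HT H0] /eqP; have /posdef_psd H0' := conj HT H0.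
have Dpsd := psd_congr D H0'.
have E i : (D *m H *m D^T) i i = (row i D *m H *m (row i D)^T) 0 0.
  rewrite -row_mul [LHS]mxE [RHS]mxE; apply: eq_bigr => j _.
  by congr (_ * _); rewrite ?[RHS]mxE// !mxE.
rewrite psumr_eq0 => [|i _]; last first.
  by rewrite E; have [_ /(_ (row i D)^T)] := H0'; rewrite trmxK.
move=> /allP D0; apply/row_matrixP => i; rewrite row0.
apply: contraTeq (D0 i (mem_index_enum _)) => Di /=.
rewrite E gt_eqF// -[X in X *m H]trmxK H0//.
by apply: contra Di => /eqP/(congr1 trmx); rewrite trmxK trmx0 => ->.
Qed.

(** Observability involves the powers 0 to N-1, the cost the powers 1 to N. The shift is absorbed by
    testing the observability matrix on [A *m D]: full column rank gives A D = 0, and [A] is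
    cancelled. *)
Lemma observable_eq0 N m q (C : 'M[R]_(m, N)) (A : 'M[R]_N) (D : 'M[R]_(N, q)) :
  observable C A -> A \in unitmx ->
  (forall n, (1 <= n < N.+1)%N -> C *m A ^+ n *m D = 0) -> D = 0.
Proof.
move=> CA A_unit CAD.
have full : row_full (\mxcol_(i < N) (C *m A ^+ i)) by rewrite /row_full CA.
apply: (can_inj (mulKmx A_unit)); rewrite mulmx0.
apply: (row_full_inj full); rewrite !mxcol_mul; apply: eq_mxcol => i.
by rewrite mulmx0 mulmxA -(mulmxA C) -[RHS](CAD i.+1) ?ltnS ?ltn_ord// exprSr.
Qed.

Definition output_gramian (N m : nat) (A : 'M[R]_N) (C : 'M[R]_(m, N)) :
    'M[R]_N :=
  \sum_(1 <= n < N.+1) (C *m A ^+ n)^T *m (C *m A ^+ n).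

(** The trace is the sum over n of the nonnegative tr ((C A^n D) H (C A^n D)^T). Each term vanishes,
    hence each C A^n D by definiteness of [H], and observability concludes. *)
Lemma mxtrace_output_gramian_eq0 N m (C : 'M[R]_(m, N)) (A : 'M[R]_N)
    (H : 'M[R]_m) (D : 'M[R]_(N, m)) :
  observable C A -> A \in unitmx -> posdef H ->
  \tr (D *m H *m D^T *m output_gramian A C) = 0 ->
  D = 0.
Proof.
move=> CA A_unit H0 /eqP; rewrite mxtrace_gram psumr_eq0 => [|k _]; last first.
  by apply/mxtrace_psd_ge0/psd_congr/psd_congr/posdef_psd.
move=> /allP tr0; apply: (observable_eq0 CA A_unit) => n n1N.
have /eqP := tr0 n (ltac:(by rewrite mem_index_iota)).
rewrite -!mulmxA -trmx_mul !mulmxA => /mxtrace_posdef_congr_eq0; exact.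
Qed.

(** * Joseph form of the covariance update *)

Context (N m : nat) (A : 'M[R]_N) (C : 'M[R]_(m, N)).

(* The covariance of (A - KCA) e + (1 - KC) omega - K v for uncorrelated e,
   omega and v of covariances P, Q and Rv. *)
Definition joseph (Q : 'M[R]_N) (Rv : 'M[R]_m) (K : 'M[R]_(N, m))
    (P : 'M[R]_N) : 'M[R]_N :=
  (A - K *m C *m A) *m P *m (A - K *m C *m A)^T
    + (1%:M - K *m C) *m Q *m (1%:M - K *m C)^T + K *m Rv *m K^T.

Lemma joseph_psd Q Rv K P : psd Q -> psd Rv -> psd P -> psd (joseph Q Rv K P).
Proof. by move=> ? ? ?; do 2 ?apply: psdD; exact: psd_congr. Qed.

(** The noise terms cancel and the remaining one is linear in the covariance. As the result is a
    congruence of P - P', this expresses monotonicity in the covariance. *)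
Lemma joseph_diff Q Rv K P P' :
  joseph Q Rv K P - joseph Q Rv K P' =
  (A - K *m C *m A) *m (P - P') *m (A - K *m C *m A)^T.
Proof.
rewrite [X in _ = X *m _]mulmxBr [RHS]mulmxBl /joseph !opprD.
by do 2 rewrite addrACA subrr addr0.
Qed.

(* Completing the square in K. *)
Lemma joseph_kalman (Q : nat -> 'M[R]_N) (Rv : nat -> 'M[R]_m) t K
    (P : 'M[R]_N) :
  P^T = P -> (Q t)^T = Q t -> posdef (kalman_H A C Q Rv t P) ->
  let Z := kalman_Z A C Q t P in
  let H := kalman_H A C Q Rv t P in
  joseph (Q t) (Rv t.+1) K P =
  A *m P *m A^T + Q t - Z *m invmx H *m Z^T
    + (K - Z *m invmx H) *m H *m (K - Z *m invmx H)^T.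
Proof.
move=> PT QT H_posdef Z H.
have [HT _] := H_posdef; have H_unit := posdef_unitmx H_posdef.
rewrite -/H in HT H_unit.
(* [S] is the predicted covariance. Since Z = S C^T, H = C S C^T + R_(t+1) and A - KCA = (1 - KC) A,
   the matrices [A], [P] and [Q t] enter only through [S]. *)
pose S := A *m P *m A^T + Q t.
have ST : S^T = S by rewrite linearD /= !trmx_mul PT QT trmxK mulmxA.
have ZE : Z = S *m C^T by rewrite /Z /kalman_Z trmx_mul /S mulmxDl !mulmxA.
have HE : H = C *m S *m C^T + Rv t.+1.
  by rewrite /H /kalman_H trmx_mul /S mulmxDr mulmxDl !mulmxA addrAC.
have -> : joseph (Q t) (Rv t.+1) K P = S - K *m Z^T - Z *m K^T + K *m H *m K^T.
  have AE : A - K *m C *m A = (1%:M - K *m C) *m A by rewrite mulmxBl mul1mx.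
  rewrite /joseph AE trmx_mul !mulmxA -mulmxDl.
  rewrite -!(mulmxA _ _ A^T) -!(mulmxA _ A) -mulmxDr mulmxA.
  rewrite -/S HE mulmxDr mulmxDl addrA; congr (_ + _).
  rewrite ZE trmx_mul trmxK ST linearB /= trmx1 trmx_mul.
  rewrite mulmxBr mulmx1 !mulmxBl mul1mx opprB !mulmxA.
  by rewrite addrA addrAC.
have -> : (K - Z *m invmx H) *m H = K *m H - Z.
  by rewrite mulmxBl mulmxKV.
rewrite -/S linearB /= trmx_mul trmx_inv HT mulmxBr !mulmxBl !mulmxA mulmxK//.
by rewrite opprB addrA addrAC !addrA addrAC subrK.
Qed.

(** * Riccati recursion and comparison with an arbitrary gain *)

Context (Q : nat -> 'M[R]_N) (Rv : nat -> 'M[R]_m) (P0 : 'M[R]_N).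
Hypotheses (Q_posdef : forall t, posdef (Q t))
  (Rv_posdef : forall t, posdef (Rv t)) (P0_psd : psd P0).

Lemma kalman_H_posdef t P : psd P -> posdef (kalman_H A C Q Rv t P).
Proof.
move=> P_psd; rewrite /kalman_H addrAC addrC; apply: posdefDl => //.
by apply: psdD; apply: psd_congr => //; exact: posdef_psd.
Qed.

(** The Riccati step subtracts a term, which hides semidefiniteness. At the Kalman gain the
    completed square vanishes, so the step is a Joseph form, that is, a sum of congruences. *)
Lemma kalman_P_psd t : psd (kalman_P A C Q Rv P0 t).
Proof.
elim: t => [//|t IHt].
have := joseph_kalman (kalman_gain A C Q Rv P0 t) IHt.1 (Q_posdef t).1
  (kalman_H_posdef t IHt).
rewrite /= subrr mul0mx mul0mx addr0 => <-.
by apply: joseph_psd => //; exact: posdef_psd.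
Qed.

Fixpoint error_cov (K : nat -> 'M[R]_(N, m)) (t : nat) : 'M[R]_N :=
  if t is s.+1 then joseph (Q s) (Rv s.+1) (K s) (error_cov K s) else P0.

(** Agreement is asked only before [n] because a tuple of Kalman gains, read as a sequence, is 0
    beyond the horizon. *)
Lemma error_cov_kalman K n :
  (forall t, (t < n)%N -> K t = kalman_gain A C Q Rv P0 t) ->
  error_cov K n = kalman_P A C Q Rv P0 n.
Proof.
elim: n => [//|n IHn] KE /=; rewrite IHn => [|t tn]; last exact/KE/ltnW.
rewrite KE// (joseph_kalman _ (kalman_P_psd n).1 (Q_posdef n).1
  (kalman_H_posdef n (kalman_P_psd n))).
by rewrite subrr mul0mx mul0mx addr0.
Qed.

(** The term D_t H*_t D_t^T: the loss due to the gain at step t alone, measured at the optimal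
    covariance. *)
Definition kalman_excess (K : nat -> 'M[R]_(N, m)) t : 'M[R]_N :=
  (K t - kalman_gain A C Q Rv P0 t)
    *m kalman_H A C Q Rv t (kalman_P A C Q Rv P0 t)
    *m (K t - kalman_gain A C Q Rv P0 t)^T.

Lemma kalman_excess_psd K t : psd (kalman_excess K t).
Proof. exact/psd_congr/posdef_psd/kalman_H_posdef/kalman_P_psd. Qed.

(** The completed square writes the subtracted sum as a Joseph form with the gain [K t], so the gap
    is a congruence of S_t - P*_t, which is semidefinite by induction. *)
Lemma error_cov_gap K t :
  psd (error_cov K t.+1 - (kalman_P A C Q Rv P0 t.+1 + kalman_excess K t)).
Proof.
have step j : error_cov K j.+1 -
    (kalman_P A C Q Rv P0 j.+1 + kalman_excess K j) =
    (A - K j *m C *m A) *m (error_cov K j - kalman_P A C Q Rv P0 j)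
      *m (A - K j *m C *m A)^T.
  rewrite -(joseph_diff (Q j) (Rv j.+1)); congr (_ - _).
  rewrite (joseph_kalman _ (kalman_P_psd j).1 (Q_posdef j).1)//.
  exact/kalman_H_posdef/kalman_P_psd.
suff gap_psd j : psd (error_cov K j - kalman_P A C Q Rv P0 j).
  by rewrite step; exact: psd_congr.
elim: j => [|j IHj]; first by rewrite subrr; exact: psd0.
(* Adding the excess back to the congruence gives S_(j+1) - P*_(j+1). *)
have := psdD (psd_congr (A - K j *m C *m A) IHj) (kalman_excess_psd K j).
by rewrite -step opprD addrA subrK.
Qed.

(** Pairing with a Gram weight preserves the semidefinite order, so the gaps can be summed over
    time. Both optimality and uniqueness are read off this bound. *)
Lemma error_cov_cost K M :
  \sum_(t < M) \tr (kalman_P A C Q Rv P0 t.+1 *m output_gramian A C)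
    + \sum_(t < M) \tr (kalman_excess K t *m output_gramian A C)
  <= \sum_(t < M) \tr (error_cov K t.+1 *m output_gramian A C).
Proof.
rewrite -big_split ler_sum// => t _ /=.
rewrite -subr_ge0 -raddfD -mulmxDl -raddfB -mulmxBl.
exact/mxtrace_psd_gram_ge0/error_cov_gap.
Qed.

End KalmanRiccati.

(** * The estimation error as a random process, and its cost *)

Section ErrorProcess.
Context (d : measure_display) (T : measurableType d) (R : realType)
  (P : probability T R).

(** u^T X X^T u is the square of u^T X, so its mean is nonnegative. This makes [P0], known only as a
    second moment, semidefinite. *)
Lemma has_mean_outer_psd n (X : T -> 'cV[R]_n) (S : 'M[R]_n) :
  has_mean P (fun w => X w *m (X w)^T) S -> psd S.
Proof.
move=> XS; split.
  apply/matrixP => i j; rewrite mxE; apply: EFin_inj.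
  rewrite -(XS i j).2 -(XS j i).2; apply: eq_integral => w _.
  by rewrite !mxE; congr EFin; apply: eq_bigr => k _; rewrite !mxE mulrC.
move=> u; rewrite -lee_fin.
rewrite -(has_meanMr u (has_meanMl u^T XS) 0 0).2; apply: integral_ge0 => w _.
rewrite lee_fin mulmxA -mulmxA -[X in _ *m X]trmxK trmx_mul trmxK.
by rewrite mxE big_ord1 [X in _ * X]mxE -expr2 sqr_ge0.
Qed.

Context (M N m : nat) (A : 'M[R]_N) (C : 'M[R]_(m, N)) (xbar0 : 'cV[R]_N)
  (x0 : T -> 'cV[R]_N) (omega : nat -> T -> 'cV[R]_N)
  (v : nat -> T -> 'cV[R]_m) (Q : nat -> 'M[R]_N) (Rv : nat -> 'M[R]_m)
  (P0 : 'M[R]_N).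
Hypotheses
  (x0_meas : forall i, measurable_fun [set: T] (fun w => x0 w i 0))
  (omega_meas : forall t i, measurable_fun [set: T] (fun w => omega t w i 0))
  (v_meas : forall t i, measurable_fun [set: T] (fun w => v t w i 0))
  (x0_mean : has_mean P x0 xbar0)
  (omega_mean : forall t, has_mean P (omega t) 0)
  (v_mean : forall t, has_mean P (v t) 0)
  (x0_cov : has_mean P (fun w => (x0 w - xbar0) *m (x0 w - xbar0)^T) P0)
  (omega_cov : forall t,
     has_mean P (fun w => omega t w *m (omega t w)^T) (Q t))
  (v_cov : forall t, has_mean P (fun w => v t w *m (v t w)^T) (Rv t))
  (indep : mutually_independent P (source_sigma x0 omega v)).

Let source_indep a b E F : a != b -> source_sigma x0 omega v a E ->
  source_sigma x0 omega v b F -> P (E `&` F) = (P E * P F)%E.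
Proof.
(* The family is [E] at [a] and [F] elsewhere, tested on the two indices [a] and [b]. *)
move=> ab aE bF; pose G c := if c == a then E else F.
have := indep (J := [:: a; b]) (E := G).
rewrite /= inE ab !big_cons !big_nil /G eqxx eq_sym (negPf ab) setIT mule1.
apply=> // c; rewrite !inE => /orP[]/eqP->; rewrite ?eqxx//.
by rewrite eq_sym (negPf ab).
Qed.

Variable K : M.-tuple 'M[R]_(N, m).
Let e t w := state A x0 omega t w - estimate A C xbar0 x0 omega v K t w.

Let errorS t w : e t.+1 w =
  (A - K`_t *m C *m A) *m e t w + (1%:M - K`_t *m C) *m omega t w
    + (- K`_t) *m v t.+1 w.
Proof.
rewrite /e /=; set x := state _ _ _ _ _; set y := estimate _ _ _ _ _ _ _ _ _.
rewrite (mulmxBl A) (mulmxBl 1%:M) mul1mx mulNmx (mulmxBr A) !opprD !addrA.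
by do 2 rewrite (addrAC _ _ (omega t w)).
Qed.

Let error_crossS q t (Y : T -> 'cV[R]_q) :
  has_mean P (fun w => e t w *m (Y w)^T) 0 ->
  has_mean P (fun w => omega t w *m (Y w)^T) 0 ->
  has_mean P (fun w => v t.+1 w *m (Y w)^T) 0 ->
  has_mean P (fun w => e t.+1 w *m (Y w)^T) 0.
Proof.
move=> eY oY vY.
have := has_meanD (has_meanD (has_meanMl (A - K`_t *m C *m A) eY)
  (has_meanMl (1%:M - K`_t *m C) oY)) (has_meanMl (- K`_t) vY).
apply: eq_has_mean => [w|]; last by rewrite !mulmx0 !addr0.
by rewrite errorS [RHS]mulmxDl [X in _ = X + _]mulmxDl !mulmxA.
Qed.

Let error0_cross q (Y : T -> 'cV[R]_q) :
  has_mean P (fun w => x0 w *m (Y w)^T) 0 -> has_mean P Y 0 ->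
  has_mean P (fun w => e 0 w *m (Y w)^T) 0.
Proof.
move=> xY Y0; have := has_meanD xY (has_meanMl (- xbar0) (has_mean_tr Y0)).
apply: eq_has_mean => [w|]; last by rewrite trmx0 mulmx0 addr0.
by rewrite /e /= mulmxBl mulNmx.
Qed.

(** e_t is built from x_0, omega_0, ..., omega_(t-1) and v_1, ..., v_t, whence the bounds s >= t for
    omega and s > t for v. The induction propagates zero cross moments by linearity and thus rests
    on pairwise independence of the sources. *)
Let error_uncorrelated t :
  (forall s, (t <= s)%N -> has_mean P (fun w => e t w *m (omega s w)^T) 0) /\
  (forall s, (t < s)%N -> has_mean P (fun w => e t w *m (v s w)^T) 0).
Proof.
elim: t => [|t [IHo IHv]].
  split=> s _; apply: error0_cross => //.
  - apply: (has_mean_indep_cross0 _ _ _ x0_mean) => // E F.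
    exact: (@source_indep None (Some (inl s))).
  - apply: (has_mean_indep_cross0 _ _ _ x0_mean) => // E F.
    exact: (@source_indep None (Some (inr s))).
split=> s ts; apply: error_crossS.
- exact/IHo/ltnW.
- apply: (has_mean_indep_cross0 _ _ _ (omega_mean t)) => // E F.
  apply: (@source_indep (Some (inl t)) (Some (inl s))).
  by rewrite (inj_eq Some_inj) (inj_eq inl_inj) ltn_eqF.
- apply: (has_mean_indep_cross0 _ _ _ (v_mean t.+1)) => // E F.
  exact: (@source_indep (Some (inr t.+1)) (Some (inl s))).
- exact/IHv/ltnW.
- apply: (has_mean_indep_cross0 _ _ _ (omega_mean t)) => // E F.
  exact: (@source_indep (Some (inl t)) (Some (inr s))).
- apply: (has_mean_indep_cross0 _ _ _ (v_mean t.+1)) => // E F.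
  apply: (@source_indep (Some (inr t.+1)) (Some (inr s))).
  by rewrite (inj_eq Some_inj) (inj_eq inr_inj) ltn_eqF.
Qed.

Let error_cov_mean t :
  has_mean P (fun w => e t w *m (e t w)^T)
    (error_cov A C Q Rv P0 (fun s => K`_s) t).
Proof.
elim: t => [|t IHt]; first exact: x0_cov.
have [eo ev] := error_uncorrelated t.
have ov : has_mean P (fun w => omega t w *m (v t.+1 w)^T) 0.
  apply: (has_mean_indep_cross0 _ _ _ (omega_mean t)) => // E F.
  exact: (@source_indep (Some (inl t)) (Some (inr t.+1))).
pose F := A - K`_t *m C *m A; pose G := 1%:M - K`_t *m C.
have S1 := has_mean_outerD (has_mean_outerM F F IHt)
  (has_mean_outerM G G (omega_cov t)).
have Z0 p q r s (F1 : 'M[R]_(p, q)) (F2 : 'M[R]_(r, s)) : F1 *m 0 *m F2 = 0.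
  by rewrite mulmx0 mul0mx.
have eo' := has_mean_outerM F G (eo t (leqnn t)); rewrite Z0 in eo'.
have ev' := has_mean_outerM F (- K`_t) (ev t.+1 (leqnn _)); rewrite Z0 in ev'.
have ov' := has_mean_outerM G (- K`_t) ov; rewrite Z0 in ov'.
(* The v term is uncorrelated with the sum of the other two, so [has_mean_outerD] applies a second
   time. *)
have eov : has_mean P (fun w =>
    (F *m e t w + G *m omega t w) *m (- K`_t *m v t.+1 w)^T) 0.
  have := has_meanD ev' ov'; apply: eq_has_mean => [w|]; last by rewrite addr0.
  by rewrite mulmxDl.
have := has_mean_outerD (S1 eo')
  (has_mean_outerM (- K`_t) (- K`_t) (v_cov t.+1)) eov.
apply: eq_has_mean => [w|]; first by rewrite errorS.
by rewrite /= /joseph linearN /= mulmxN !mulNmx opprK.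
Qed.

Lemma estimation_costE :
  estimation_cost P A C xbar0 x0 omega v K =
  (\sum_(t < M) \tr (error_cov A C Q Rv P0 (fun s => K`_s) t.+1
                      *m output_gramian A C))%:E.
Proof.
rewrite -raddf_sum; apply: has_mean_mxtrace; apply: has_mean_sum => t.
exact/has_meanMr/error_cov_mean.
Qed.

End ErrorProcess.

(** * Optimality and uniqueness of the Kalman gain *)

Theorem corollary1 (d : measure_display) (T : measurableType d) (R : realType)
    (P : probability T R) (M N m : nat)
    (M_gt0 : (0 < M)%N) (N_gt0 : (0 < N)%N) (m_gt0 : (0 < m)%N)
    (A : 'M[R]_N) (C : 'M[R]_(m, N))
    (xbar0 : 'cV[R]_N) (Sigma0 : 'M[R]_N)
    (Q : nat -> 'M[R]_N) (Rv : nat -> 'M[R]_m)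
    (x0 : T -> 'cV[R]_N) (omega : nat -> T -> 'cV[R]_N)
    (v : nat -> T -> 'cV[R]_m) (P0 : 'M[R]_N)
    (x0_normal : has_normal_law P x0 xbar0 Sigma0)
    (omega_gauss : forall t, gaussian_vector P (omega t))
    (v_gauss : forall t, gaussian_vector P (v t))
    (omega_mean : forall t, has_expectation P (omega t) 0)
    (v_mean : forall t, has_expectation P (v t) 0)
    (omega_cov : forall t,
       has_expectation P (fun w => omega t w *m (omega t w)^T) (Q t))
    (v_cov : forall t,
       has_expectation P (fun w => v t w *m (v t w)^T) (Rv t))
    (indep : mutually_independent P (source_sigma x0 omega v))
    (P0E : has_expectation P
       (fun w => (x0 w - xbar0) *m (x0 w - xbar0)^T) P0)
    (Q_posdef : forall t, posdef (Q t))
    (Rv_posdef : forall t, posdef (Rv t))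
    (CA_observable : observable C A)
    (A_unit : A \in unitmx) :
  forall K : M.-tuple 'M[R]_(N, m),
    (forall K' : M.-tuple 'M[R]_(N, m),
       (estimation_cost P A C xbar0 x0 omega v K
          <= estimation_cost P A C xbar0 x0 omega v K')%E)
    <-> K = [tuple kalman_gain A C Q Rv P0 t | t < M].
Proof.
have [[x0_meas _] x0_mean _] := x0_normal.
have omega_meas t i := (omega_gauss t).1 i.
have v_meas t i := (v_gauss t).1 i.
have cV_mean n (X : T -> 'cV[R]_n) mu :
    (forall i, measurable_fun [set: T] (fun w => X w i 0)) ->
    has_expectation P X mu -> has_mean P X mu.
  by move=> mX; apply: has_expectation_mean => i j; rewrite ord1.
have x0_cov : has_mean P (fun w => (x0 w - xbar0) *m (x0 w - xbar0)^T) P0.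
  apply: has_mean_expectation_outer => // i.
  under eq_fun do rewrite mxE [X in _ + X]mxE.
  exact: measurable_funB.
have costE := estimation_costE A C x0_meas omega_meas v_meas
  (cV_mean _ _ _ x0_meas x0_mean)
  (fun t => cV_mean _ _ _ (omega_meas t) (omega_mean t))
  (fun t => cV_mean _ _ _ (v_meas t) (v_mean t)) x0_cov
  (fun t => has_mean_expectation_outer (omega_meas t) (omega_cov t))
  (fun t => has_mean_expectation_outer (v_meas t) (v_cov t)) indep.
have P0_psd := has_mean_outer_psd x0_cov.
set Kopt := [tuple kalman_gain A C Q Rv P0 t | t < M].
have KoptE t : (t < M)%N -> Kopt`_t = kalman_gain A C Q Rv P0 t.
  by move=> tM; rewrite -[t]/(val (Ordinal tM)) -tnth_nth tnth_mktuple.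
have optE : estimation_cost P A C xbar0 x0 omega v Kopt =
    (\sum_(t < M) \tr (kalman_P A C Q Rv P0 t.+1 *m output_gramian A C))%:E.
  rewrite costE; congr EFin; apply: eq_bigr => t _.
  rewrite error_cov_kalman// => s st; apply: KoptE.
  exact: leq_trans st (ltn_ord t).
have gap K' := error_cov_cost A C Q_posdef Rv_posdef P0_psd (fun t => K'`_t) M.
move=> K; split => [Kmin|-> K'].
  (* Comparison with [Kopt] turns the bound into optimum + total excess <= optimum. *)
  have := Kmin Kopt; rewrite optE costE lee_fin => /(le_trans (gap K)).
  rewrite gerDl => gap_le0; apply: eq_from_tnth => t.
  rewrite (tnth_nth 0) tnth_mktuple; apply/eqP; rewrite -subr_eq0; apply/eqP.
  have P_psd := kalman_P_psd A C Q_posdef Rv_posdef P0_psd t.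
  apply: (mxtrace_output_gramian_eq0 CA_observable A_unit
    (kalman_H_posdef A C Q_posdef Rv_posdef t P_psd)).
  (* A total excess that is at most 0 with nonnegative terms forces the term at [t] to vanish. *)
  have gap_ge0 s : 0 <= \tr (kalman_excess A C Q Rv P0 (fun t => K`_t) s
                               *m output_gramian A C).
    exact/mxtrace_psd_gram_ge0/kalman_excess_psd.
  apply/eqP; rewrite eq_le gap_ge0 andbT; apply: le_trans gap_le0.
  by rewrite (bigD1 t)//= lerDl sumr_ge0.
(* Conversely, the cost of [K'] exceeds the optimum by at least its total excess, which is
   nonnegative. *)
rewrite optE costE lee_fin; apply: le_trans (gap K').
rewrite lerDl; apply: sumr_ge0 => t _.
exact/mxtrace_psd_gram_ge0/kalman_excess_psd.
Qed.
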